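(* The following quasi-orthogonality relations hold, for integers $j,k\ge0$: $$\int_{-1}^1\mathbf{P}_j(x)\,W(x)\,\mathbf{P}_k(x)\,dx=0\quad\text{for } j<k,$$ and $$\int_{-1}^1W(x)\,\mathbf{P}_j(x)\,\mathbf{P}_k(x)\,dx=0\quad\text{for } j>k,$$ provided that the integrals exist.
   Context: Let $d\ge1$ and let $A,B$ be $d\times d$ complex matrices such that (i) $A+B$ is diagonalizable, and (ii) (nonresonance) the eigenvalues $\lambda_1,\dots,\lambda_d$ of $A+B$ (listed with multiplicity), with $\boldsymbol{\lambda}=(\lambda_1,\dots,\lambda_d)$, satisfy $\mathbf{m}\cdot\boldsymbol{\lambda}-\lambda_j\notin\mathbb{Z}_-=\{-1,-2,-3,\dots\}$ for all $\mathbf{m}\in\mathbb{N}^d$ and $j=1,\dots,d$, where $\mathbb{N}=\{0,1,2,\dots\}$. Put $M(x)=\frac{1}{x-1}A+\frac{1}{x+1}B$ and $Q(x)=x^2-1$. Let $Y$ be a fundamental matrix of solutions of $\mathbf{y}'=M\mathbf{y}$ on the interval $(-1,1)$ (so $Y'=MY$, $Y$ invertible). For $n\in\mathbb{N}$, let $\mathcal{P}_n$ be the space of $\mathbb{C}^d$-valued polynomials $\mathbf{q}(\mathbf{w})$ in $\mathbf{w}=(w_1,\dots,w_d)$ that are homogeneous of degree $n$. For $x\in(-1,1)$ let $W(x)$ be the (invertible) linear operator on $\mathcal{P}_n$ given by $W(x)\mathbf{q}(\mathbf{w})=Y(x)^{-1}\,\mathbf{q}(Y(x)\mathbf{w})$.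 For $k\ge0$ the linear operator $\mathbf{P}_k(x)$ on $\mathcal{P}_n$ is defined by $$\mathbf{P}_k(x)=W(x)^{-1}\frac{d^k}{dx^k}\left[Q(x)^kW(x)\right],$$ equivalently $\mathbf{P}_k(x)\mathbf{q}(\mathbf{w})=Y(x)\,\frac{d^k}{dt^k}\big|_{t=x}\left[Q(t)^k\,Y^{-1}(t)\,\mathbf{q}\left(Y(t)Y^{-1}(x)\mathbf{w}\right)\right]$; it is a polynomial in $x$ of degree $k$ with coefficients linear operators on $\mathcal{P}_n$. Products of operators are compositions on the finite-dimensional space $\mathcal{P}_n$, and integrals are of operator-valued functions (entrywise in a basis).
   Formalization: ''Provided that the integrals exist'' is taken as: in each relation the integrals exist (absolutely) for all j,k ≥ 0, including j=k=0, so W is integrable; with only the integral in question existing the claim fails (d=1, A=1, B=1/2, n=0, j=0, k=1 gives −√2). *)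

(* Defs.v *)
From HB Require Import structures.
From mathcomp Require Import all_boot all_order all_algebra.
From mathcomp Require Import complex.
(* mpoly's notations clash with those of mathcomp-analysis. *)
From mathcomp Require Import -(notations) mpoly.
From mathcomp Require Import all_classical all_reals all_analysis.

Set Implicit Arguments.
Unset Strict Implicit.
Unset Printing Implicit Defensive.

Import Order.TTheory GRing.Theory Num.Theory.
Import numFieldNormedType.Exports.

Local Open Scope ring_scope.
Local Open Scope classical_set_scope.
Local Open Scope complex_scope.

Section ComplexCalculus.
Variable R : realType.

Definition is_cderive (f : R -> R[i]) (x : R) (l : R[i]) : Prop :=
  is_derive x 1 (fun t => complex.Re (f t)) (complex.Re l) /\
  is_derive x 1 (fun t => complex.Im (f t)) (complex.Im l).

Definition cderive (f : R -> R[i]) (x : R) : R[i] :=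
  (fun t => complex.Re (f t))^`() x +i* (fun t => complex.Im (f t))^`() x.

Definition cintegrable (D : set R) (f : R -> R[i]) : Prop :=
  lebesgue_measure.-integrable D (fun x => (complex.Re (f x))%:E) /\
  lebesgue_measure.-integrable D (fun x => (complex.Im (f x))%:E).

Definition cintegral (D : set R) (f : R -> R[i]) : R[i] :=
  (\int[lebesgue_measure]_(x in D) complex.Re (f x)) +i*
  (\int[lebesgue_measure]_(x in D) complex.Im (f x)).

(* Derivatives and integrals of functions with values in a finite-dimensional
   complex space E are taken coordinatewise; by linearity nothing depends on
   the basis, so we use the one provided by [vbasis].  For E = 'End(V) these
   are the entrywise derivative and integral of an operator-valued function. *)
Variable E : vectType R[i].

Definition vcoord (i : 'I_(\dim {:E})) (v : E) : R[i] :=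
  coord (vbasis {:E}) i v.

Definition vderive (F : R -> E) (x : R) : E :=
  \sum_i cderive (fun t => vcoord i (F t)) x *: (vbasis {:E})`_i.

Definition vderiven (k : nat) (F : R -> E) : R -> E := iter k vderive F.

Definition vintegrable (D : set R) (F : R -> E) : Prop :=
  forall i, cintegrable D (fun t => vcoord i (F t)).

Definition vintegral (D : set R) (F : R -> E) : E :=
  \sum_i cintegral D (fun t => vcoord i (F t)) *: (vbasis {:E})`_i.

End ComplexCalculus.

Section HomogeneousPolynomials.
Variables (K : fieldType) (d n : nat).

(* The dimension is d.+1, so that it is at least 1 (and so that [dhomog] is
   finite-dimensional by a library instance).
   [linear_forms T] lists the entries of T w, as polynomials in w. *)
Definition linear_forms (T : 'M[K]_d.+1) : d.+1.-tuple (mpoly d.+1 K) :=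
  [tuple \sum_j T i j *: mpolyX K (mnm1 j) | i < d.+1].

Lemma comp_linear_forms_homog (T : 'M[K]_d.+1) (p : dhomog d.+1 K n) :
  comp_mpoly (linear_forms T) (mpoly_of_dhomog p) \is ishomog1 n mdeg.
Proof.
have formP i : tnth (linear_forms T) i \is ishomog1 1 mdeg.
  rewrite tnth_mktuple rpred_sum // => j _.
  by apply: rpredZ; rewrite dhomogX /= mdeg1.
rewrite comp_mpolyEX big_seq; apply: rpred_sum => m pm; apply: rpredZ.
have <- : mdeg m = n.
  by have /dhomogP /(_ m pm) := dhomog_is_dhomog p.
rewrite comp_mpolyX mdegE.
elim/big_rec2: _ => [|i a b _ bP]; first exact: dhomog1.
apply: dhomogM => //; rewrite -[X in ishomog1 X]mul1n; exact: dhomogMn.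
Qed.

Definition hsubst (T : 'M[K]_d.+1) (p : dhomog d.+1 K n) : dhomog d.+1 K n :=
  DHomog (comp_linear_forms_homog T p).

(* K^(d+1)-valued polynomials in d+1 variables, homogeneous of degree n. *)
Definition hvect : vectType K := {ffun 'I_d.+1 -> dhomog d.+1 K n}.

Definition conj_subst_fun (T : 'M[K]_d.+1) (q : hvect) : hvect :=
  [ffun i => \sum_j invmx T i j *: hsubst T ((q : {ffun _ -> _}) j)].

Lemma conj_subst_is_linear (T : 'M[K]_d.+1) : linear (conj_subst_fun T).
Proof.
have hsubstP a p q : hsubst T (a *: p + q) = a *: hsubst T p + hsubst T q.
  by apply/val_inj; rewrite /= linearP.
move=> a p q; apply/ffunP => i; rewrite !ffunE scaler_sumr -big_split /=.
apply: eq_bigr => j _; rewrite !ffunE hsubstP scalerDr.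
by rewrite !scalerA [a * _]mulrC.
Qed.

HB.instance Definition _ (T : 'M[K]_d.+1) :=
  GRing.isLinear.Build K hvect hvect _ (conj_subst_fun T)
    (conj_subst_is_linear T).

(* q(w) |-> T^-1 q(T w) *)
Definition conj_subst (T : 'M[K]_d.+1) : 'End(hvect) :=
  linfun (conj_subst_fun T).

Lemma conj_substE (T : 'M[K]_d.+1) (q : hvect) :
  conj_subst T q = conj_subst_fun T q.
Proof. exact: lfunE. Qed.

End HomogeneousPolynomials.

Section Rodrigues.
Variables (R : realType) (d : nat).
Implicit Types (A B : 'M[R[i]]_d.+1) (Y : R -> 'M[R[i]]_d.+1).

Definition nonresonant (lambda : 'I_d.+1 -> R[i]) : Prop :=
  forall (m : 'I_d.+1 -> nat) (j : 'I_d.+1),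
    ~ exists l : nat, (0 < l)%N /\
        \sum_i (m i)%:R * lambda i - lambda j = - l%:R.

Definition system_matrix A B (x : R) : 'M[R[i]]_d.+1 :=
  ((x - 1)^-1)%:C *: A + ((x + 1)^-1)%:C *: B.

Definition fundamental_matrix A B Y : Prop :=
  forall x, x \in `]-1, 1[ ->
    (forall i j,
       is_cderive (fun t => Y t i j) x ((system_matrix A B x *m Y x) i j)) /\
    Y x \in unitmx.

Definition weight (n : nat) Y (x : R) : 'End(hvect R[i] d n) :=
  conj_subst n (Y x).

Definition Qpoly (x : R) : R := x ^+ 2 - 1.

(* Existence of one integral of P_j W P_k with j < k does not make it vanish,
   because the boundary terms need not: in dimension 1 with A = 1, B = 1/2,
   n = 0, one has W = (1-x)^-1 (1+x)^(-1/2), P_0 = 1, P_1 = - (1-x)/2, and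
   W P_1 is integrable on ]-1, 1[ with integral - sqrt 2.  Hence "provided that
   the integrals exist" has to be read for all j, k >= 0 together; for
   j = k = 0 it says that W is integrable. *)
Definition rodrigues (n : nat) Y (k : nat) (x : R) : 'End(hvect R[i] d n) :=
  ((weight n Y x)^-1 \o
    vderiven k (fun t => (Qpoly t ^+ k)%:C *: weight n Y t) x)%VF.

End Rodrigues.

(* Main.v *)
Require Import Defs.
From HB Require Import structures.
From mathcomp Require Import all_boot all_order all_algebra.
From mathcomp Require Import complex ring lra.
From mathcomp Require Import -(notations) mpoly.
From mathcomp Require Import all_classical all_reals all_analysis measurable_realfun.

Set Implicit Arguments.
Unset Strict Implicit.
Unset Printing Implicit Defensive.

Import Order.TTheory GRing.Theory Num.Theory.
Import numFieldNormedType.Exports.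

Local Open Scope ring_scope.
Local Open Scope classical_set_scope.
Local Open Scope complex_scope.

(** Let W be the weight, C the operator q(w) |-> T^-1 q(T w) on homogeneous
    polynomial vectors, and D the differential of C at T = 1, so that
    W(x) = C(Y(x)).  The map C reverses products ([conj_subst_mul]), hence
    W(t) = W(x) o C(Y(t) Y(x)^-1), and Y' = M Y gives the linear equation
    W' = W o D(M(x)) ([weight_derivative]).  As D is linear, D(M(x)) has only
    simple poles at 1 and -1, and Q(x) D(M(x)) is an operator polynomial of
    degree at most 1.  For an operator polynomial S this makes
      (Q^(m+1) W S)' = Q^m W T
    with an operator polynomial T of degree at most deg S + 1
    ([rodrigues_step]).  Hence (Q^k W)^(i) = Q^(k-i) W S_i with deg S_i <= i
    ([rodrigues_derivative]), and P_k is the polynomial S_k.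

    Every coordinate of either integrand is therefore a sum of terms
    x^a psi((Q^l W)^(l)), where l is the larger of j and k, a < l and psi is
    a linear functional: in the first relation
    W P_k = (Q^k W)^(k) and P_j is a polynomial on its left, in the second
    W P_j = (Q^j W)^(j) and P_k is a polynomial on its right.  Integrating by
    parts a + 1 times gives 0 ([rodrigues_moment]), as soon as the boundary
    terms vanish.

    The boundary terms are values of f = Q h near 1 and -1, where
    h = phi(W S) is integrable, because the case j = k = 0 of the hypothesis
    says that W is.  If f stayed away from 0 near an end point, h would be at
    least of the order of the inverse distance to it and could not be
    integrable; so f is small at some points as close to the ends as desired,
    and this is enough for the integral of f' to be 0
    ([integral_derivative_eq0]). *)

(** * Integrals of derivatives on the open interval *)

Section RealLine.
Variable R : realType.
Notation mu := (@lebesgue_measure R).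
Implicit Types (f g h : R -> R) (A D : set R).

Lemma near_itv11 (x : R) : x \in `]-1, 1[%R -> \forall t \near x, t \in `]-1, 1[%R.
Proof. by move=> xI; exact: near_in_itvoo. Qed.

Lemma is_derive_continuous f (x l : R) :
  is_derive x 1 f l -> {for x, continuous f}.
Proof.
by move=> [df _]; apply: differentiable_continuous; exact/derivable1_diffP.
Qed.

(** Absolute continuity of the integral, relative to a domain of
    integrability. *)
Lemma integral_abs_continuous D h (e : R) : measurable D ->
  mu.-integrable D (EFin \o h) -> 0 < e ->
  exists r : R, 0 < r /\ forall A, measurable A -> A `<=` D ->
    (mu A < r%:E)%E -> \int[mu]_(x in A) `|h x| < e.
Proof.
move=> mD ih e0.
have : mu.-integrable setT (EFin \o h \_ D).
  by rewrite -restrict_EFin; apply/integrable_restrict => //=; rewrite setTI.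
move=> /integral_normr_continuous /(_ _ e0) [r [r0 hr]].
exists r; split => // A mA AD /(hr _ mA).
congr (_ < _).
apply: eq_Rintegral => x xA /=; rewrite patchE mem_set //.
exact/AD/set_mem.
Qed.

(** Otherwise |h| would be at least e / s on the whole of A, which has
    measure s, and its integral would reach e. *)
Lemma exists_small_value A h (s e : R) : measurable A -> mu A = s%:E ->
  0 < s -> mu.-integrable A (EFin \o h) ->
  \int[mu]_(x in A) `|h x| < e -> exists2 x, A x & `|h x| * s < e.
Proof.
move=> mA As s0 ih lte.
apply: contrapT => nsmall; move: lte; apply/negP; rewrite -leNgt.
have -> : e = \int[mu]_(x in A) (e / s).
  rewrite Rintegral_cst // [X in fine X]As /= divfK ?gt_eqF //.
apply: le_Rintegral => //.
- apply: measurable_bounded_integrable => //.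
    by rewrite [X in (X < _)%E]As ltry.
  exact: bounded_cst.
- exact: integrable_norm.
move=> x Ax; rewrite ler_pdivrMr // leNgt; apply/negP => hx.
by apply: nsmall; exists x.
Qed.

Lemma integral_itv_fundamental f g (a b : R) : a < b ->
  (forall x, x \in `[a, b]%R -> is_derive x 1 f (g x)) ->
  (forall x, x \in `[a, b]%R -> {for x, continuous g}) ->
  \int[mu]_(x in `[a, b]) g x = f b - f a.
Proof.
move=> ab df cg; rewrite /Rintegral (@continuous_FTC2 _ g f a b) //.
- by apply: continuous_in_subspaceT => x xab; apply: cg; move: xab; rewrite inE.
- have cf x : x \in `[a, b]%R -> {for x, continuous f}.
    by move=> /df; exact: is_derive_continuous.
  split.
  + move=> x /subset_itv_oo_cc xab; by case: (df x xab).
  + by apply/cvg_at_right_filter; apply: cf; rewrite in_itv /= lexx ltW.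
  + by apply/cvg_at_left_filter; apply: cf; rewrite in_itv /= lexx ltW.
- move=> x /subset_itv_oo_cc xab; have [_ <-] := df x xab.
  by rewrite derive1E.
Qed.

Lemma Rintegral_itv_split g (a b u v : R) : u < a -> a < b -> b < v ->
  mu.-integrable `]u, v[ (EFin \o g) ->
  \int[mu]_(x in `]u, v[) g x = \int[mu]_(x in `]u, a[) g x +
    \int[mu]_(x in `[a, b]) g x + \int[mu]_(x in `]b, v[) g x.
Proof.
move=> ua ab bv ig.
have av := lt_trans ab bv.
have iga : mu.-integrable `]a, v[ (EFin \o g).
  by apply: integrableS ig => //; apply: subset_itvr; rewrite bnd_simp ltW.
have := @Rintegral_itvB _ g (BRight u) (BLeft v) a ig.
have := @Rintegral_itvB _ g (BRight a) (BLeft v) b iga.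
rewrite !bnd_simp => /(_ (ltW ab) bv) <- /(_ (ltW ua) av) E.
rewrite (@Rintegral_itv_bndo_bndc _ (BRight u) a); last first.
  by apply: integrableS ig => //; apply: subset_itvl; rewrite bnd_simp ltW.
rewrite -(@Rintegral_itv_obnd_cbnd _ a (BRight b)); last first.
  by apply: integrableS iga => //; apply: subset_itvl; rewrite bnd_simp.
by rewrite -E; ring.
Qed.

(** One factor of x^2 - 1 is at most 2 s in absolute value and the other at
    most 2; the two alternatives are the two ends of the interval. *)
Lemma Qpoly_small (s x : R) : 0 < s -> s <= 1 / 4 ->
  (1 - 2 * s < x < 1) || (-1 < x < -1 + 2 * s) -> `|Qpoly x| <= 4 * s.
Proof.
move=> s0 s4 xs; rewrite /Qpoly subr_sqr_1 normrM.
have -> : 4 * s = 2 * (2 * s) by ring.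
case/orP: xs => /andP[x1 x2].
  by rewrite mulrC; apply: ler_pM => //; rewrite ler_norml; apply/andP; split; lra.
by apply: ler_pM => //; rewrite ler_norml; apply/andP; split; lra.
Qed.

(** By absolute continuity the integral of |h| over an interval of length s
    at distance s from an end point is small when s is, so somewhere on it
    |h| s is small, and |f| = |Q h| is small there because |Q| <= 4 s.  With
    such points a and b the integral of g over [a, b] is f b - f a, and the
    two remaining pieces are small. *)
Lemma integral_derivative_eq0 f g h :
  (forall x : R, x \in `]-1, 1[%R -> is_derive x 1 f (g x)) ->
  (forall x : R, x \in `]-1, 1[%R -> {for x, continuous g}) ->
  (forall x : R, x \in `]-1, 1[%R -> f x = Qpoly x * h x) ->
  mu.-integrable `]-1, 1[ (EFin \o g) -> mu.-integrable `]-1, 1[ (EFin \o h) ->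
  \int[mu]_(x in `]-1, 1[) g x = 0.
Proof.
move=> df cg fE ig ih; apply/eqP; rewrite -normr_le0.
apply/ler_addgt0Pr => e' e'_gt0; rewrite add0r.
pose e := e' / 10.
have e_gt0 : 0 < e by rewrite divr_gt0.
have [r1 [r10 hr1]] := integral_abs_continuous (measurable_itv _) ig e_gt0.
have [r2 [r20 hr2]] := integral_abs_continuous (measurable_itv _) ih e_gt0.
have [s [s_gt0 s4 sr1 sr2]] :
    exists s : R, [/\ 0 < s, s <= 1 / 4, 2 * s <= r1 & 2 * s <= r2].
  clear -r10 r20; case: (leP r1 r2) => r12.
    by case: (leP (1 / 4) (r1 / 2)) => ?; [exists (1 / 4)|exists (r1 / 2)];
      split; lra.
  by case: (leP (1 / 4) (r2 / 2)) => ?; [exists (1 / 4)|exists (r2 / 2)];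
    split; lra.
have sub (u v : R) : -1 <= u -> v <= 1 -> `]u, v[ `<=` `]-1, 1[.
  by move=> u1 v1; apply: subset_itv; rewrite bnd_simp.
have muE (u v : R) : u < v -> mu `]u, v[ = (v - u)%:E.
  by move=> uv; rewrite lebesgue_measure_itv /= lte_fin uv -EFinD.
have small (u v : R) : -1 <= u -> u < v -> v <= 1 -> v - u < 2 * s ->
    `|\int[mu]_(x in `]u, v[) g x| < e.
  move=> u1 uv v1 vus; apply: le_lt_trans (le_normr_Rintegral _ _) _ => //.
    by apply: integrableS ig => //; exact: sub.
  apply: hr1 => //; first exact: sub.
  by rewrite [X in (X < _)%E]muE // lte_fin (lt_le_trans vus).
have pick (u v : R) : -1 <= u -> v <= 1 -> v - u = s ->
    (forall x, x \in `]u, v[%R -> (1 - 2 * s < x < 1) || (-1 < x < -1 + 2 * s)) ->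
    exists x : R, u < x < v /\ `|f x| < 4 * e.
  move=> u1 v1 vus Quv.
  have uv : u < v by rewrite -subr_gt0 vus.
  have [|||||x /= xuv hx] := @exists_small_value `]u, v[ h s e.
  - by [].
  - by rewrite muE // vus.
  - by [].
  - by apply: integrableS ih => //; exact: sub.
  - apply: hr2 => //; first exact: sub.
    by rewrite [X in (X < _)%E]muE // lte_fin vus; clear -s_gt0 sr2; lra.
  exists x; split; first by move: xuv; rewrite in_itv.
  rewrite fE; last exact: (sub u v).
  rewrite normrM; apply: le_lt_trans (_ : 4 * s * `|h x| < _).
    by rewrite ler_wpM2r // Qpoly_small //; exact: Quv.
  by rewrite -mulrA [s * _]mulrC ltr_pM2l.
(* A point of smallness at distance between s and 2 s from each end. *)
have [||||b [/andP[b1 b2] fb]] := pick (1 - 2 * s) (1 - s).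
- by clear -s4; lra.
- by clear -s_gt0; lra.
- by ring.
- move=> x; rewrite in_itv /= => /andP[x1 x2].
  by rewrite x1 /= (lt_trans x2) // gtrBl.
have [||||a [/andP[a1 a2] fa]] := pick (-1 + s) (-1 + 2 * s).
- by clear -s_gt0; lra.
- by clear -s4; lra.
- by ring.
- move=> x; rewrite in_itv /= => /andP[x1 x2].
  have -> : -1 < x by apply: lt_trans x1; rewrite ltrDl.
  by rewrite x2 orbT.
clear pick hr1 hr2.
have a_gt : -1 < a by apply: lt_trans a1; rewrite ltrDl.
have b_lt : b < 1 by apply: lt_trans b2 _; rewrite gtrBl.
have ab : a < b by clear -s4 a2 b1; lra.
have abI (x : R) : x \in `[a, b]%R -> x \in `]-1, 1[%R.
  rewrite !in_itv /= => /andP[ax xb].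
  by rewrite (lt_le_trans a_gt) //= (le_lt_trans xb).
rewrite (Rintegral_itv_split a_gt ab b_lt ig).
rewrite (integral_itv_fundamental ab (fun x xab => df x (abI x xab))); last first.
  by move=> x /abI; exact: cg.
have small_a : `|\int[mu]_(x in `]-1, a[) g x| < e.
  by apply: small => //; [exact: ltW (lt_trans ab b_lt)|clear -a2; lra].
have small_b : `|\int[mu]_(x in `]b, 1[) g x| < e.
  by apply: small => //; [exact: ltW (lt_trans a_gt ab)|clear -b1; lra].
have -> : e' = e + (4 * e + 4 * e) + e by rewrite /e; field.
apply: le_trans (ler_normD _ _) (lerD _ (ltW small_b)).
apply: le_trans (ler_normD _ _) (lerD (ltW small_a) _).
exact: le_trans (ler_normB _ _) (lerD (ltW fb) (ltW fa)).
Qed.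

End RealLine.

(** * Complex-valued functions of a real variable *)

Section ScalarCalculus.
Variable R : realType.
Notation C := R[i].
Implicit Types (f g : R -> C) (x : R) (l c : C).

Lemma creM (a b : C) :
  complex.Re (a * b) = complex.Re a * complex.Re b - complex.Im a * complex.Im b.
Proof. by case: a; case: b. Qed.

Lemma cimM (a b : C) :
  complex.Im (a * b) = complex.Re a * complex.Im b + complex.Im a * complex.Re b.
Proof. by case: a; case: b. Qed.

Lemma creD (a b : C) : complex.Re (a + b) = complex.Re a + complex.Re b.
Proof. by case: a; case: b. Qed.

Lemma cimD (a b : C) : complex.Im (a + b) = complex.Im a + complex.Im b.
Proof. by case: a; case: b. Qed.

Lemma creN (a : C) : complex.Re (- a) = - complex.Re a.
Proof. by case: a. Qed.

Lemma cimN (a : C) : complex.Im (- a) = - complex.Im a.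
Proof. by case: a. Qed.

Lemma is_derive_congr (h k : R -> R) x (a b : R) :
  is_derive x 1 h a -> h =1 k -> a = b -> is_derive x 1 k b.
Proof. by move=> + /funext <- <-. Qed.

Lemma is_cderive_cst c x : is_cderive (fun=> c) x 0.
Proof. by split; exact: is_derive_cst. Qed.

Lemma is_cderive_real (h : R -> R) x (a : R) :
  is_derive x 1 h a -> is_cderive (fun t => (h t)%:C) x a%:C.
Proof. by move=> ?; split => //; exact: is_derive_cst. Qed.

Lemma is_cderiveD f g x l1 l2 : is_cderive f x l1 -> is_cderive g x l2 ->
  is_cderive (fun t => f t + g t) x (l1 + l2).
Proof.
move=> [fR fI] [gR gI]; split.
  by apply: (is_derive_congr (is_deriveD fR gR)) => [t|]; rewrite creD.
by apply: (is_derive_congr (is_deriveD fI gI)) => [t|]; rewrite cimD.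
Qed.

Lemma is_cderiveM f g x l1 l2 : is_cderive f x l1 -> is_cderive g x l2 ->
  is_cderive (fun t => f t * g t) x (l1 * g x + f x * l2).
Proof.
move=> [fR fI] [gR gI]; split.
  apply: (is_derive_congr (is_deriveB (is_deriveM fR gR) (is_deriveM fI gI))).
    by move=> t; rewrite creM.
  by rewrite creD !creM /GRing.scale /=; ring.
apply: (is_derive_congr (is_deriveD (is_deriveM fR gI) (is_deriveM fI gR))).
  by move=> t; rewrite cimM.
by rewrite cimD !cimM /GRing.scale /=; ring.
Qed.

Lemma is_cderiveMl c f x l :
  is_cderive f x l -> is_cderive (fun t => c * f t) x (c * l).
Proof.
by move=> df; have := is_cderiveM (is_cderive_cst c x) df; rewrite mul0r add0r.
Qed.

Lemma is_cderive_sum (I : Type) (r : seq I) (F : I -> R -> C) x (L : I -> C) :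
  (forall i, is_cderive (F i) x (L i)) ->
  is_cderive (fun t => \sum_(i <- r) F i t) x (\sum_(i <- r) L i).
Proof.
move=> dF; elim: r => [|i r IHr].
  rewrite big_nil; under eq_fun do rewrite big_nil; exact: is_cderive_cst.
by rewrite big_cons; under eq_fun do rewrite big_cons; exact: is_cderiveD.
Qed.

Lemma near_is_cderive f g x l : (\forall t \near x, f t = g t) ->
  is_cderive f x l -> is_cderive g x l.
Proof.
move=> fg [fR fI]; split.
  by apply: near_eq_is_derive fR; apply: filterS fg => t ->.
by apply: near_eq_is_derive fI; apply: filterS fg => t ->.
Qed.

Lemma is_cderive_cderive f x l : is_cderive f x l -> cderive f x = l.
Proof. by move=> [[_ fR] [_ fI]]; rewrite /cderive !derive1E fR fI; case: l {fR fI}. Qed.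

Lemma creV (a : C) :
  complex.Re a^-1 = complex.Re a / (complex.Re a ^+ 2 + complex.Im a ^+ 2).
Proof. by case: a. Qed.

Lemma cimV (a : C) :
  complex.Im a^-1 = - complex.Im a / (complex.Re a ^+ 2 + complex.Im a ^+ 2).
Proof. by case: a => a b /=; rewrite mulNr. Qed.

Lemma is_cderiveV f x l : is_cderive f x l -> f x != 0 ->
  is_cderive (fun t => (f t)^-1) x (- l / f x ^+ 2).
Proof.
move=> [fR fI] fx0.
pose N := fun t => complex.Re (f t) * complex.Re (f t) + complex.Im (f t) * complex.Im (f t).
have Nx0 : N x != 0.
  apply: contraNneq fx0; rewrite /N eq_complex /= => N0.
  by apply/andP; split; apply/eqP; nra.
have dN := is_deriveD (is_deriveM fR fR) (is_deriveM fI fI).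
have dNV := is_deriveV Nx0 dN.
have -> : - l / f x ^+ 2 = - (l * ((f x)^-1 * (f x)^-1)).
  by rewrite expr2 invfM; ring.
(* With f = l1 + i l2 and f' = a + i b, these are the real and the imaginary
   part of (1 / f)' = - f' / f^2. *)
have keyR (a b l1 l2 : R) : l1 ^+ 2 + l2 ^+ 2 != 0 ->
    l1 * (- (l1 ^+ 2 + l2 ^+ 2) ^- 2 * (l1 * a + l1 * a + (l2 * b + l2 * b))) +
    (l1 ^+ 2 + l2 ^+ 2)^-1 * a =
    - (a * (l1 / (l1 ^+ 2 + l2 ^+ 2) * (l1 / (l1 ^+ 2 + l2 ^+ 2)) -
            - l2 / (l1 ^+ 2 + l2 ^+ 2) * (- l2 / (l1 ^+ 2 + l2 ^+ 2))) -
       b * (l1 / (l1 ^+ 2 + l2 ^+ 2) * (- l2 / (l1 ^+ 2 + l2 ^+ 2)) +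
            - l2 / (l1 ^+ 2 + l2 ^+ 2) * (l1 / (l1 ^+ 2 + l2 ^+ 2)))).
  by move=> ?; field.
have keyI (a b l1 l2 : R) : l1 ^+ 2 + l2 ^+ 2 != 0 ->
    - l2 * (- (l1 ^+ 2 + l2 ^+ 2) ^- 2 * (l1 * a + l1 * a + (l2 * b + l2 * b))) +
    (l1 ^+ 2 + l2 ^+ 2)^-1 * - b =
    - (a * (l1 / (l1 ^+ 2 + l2 ^+ 2) * (- l2 / (l1 ^+ 2 + l2 ^+ 2)) +
            - l2 / (l1 ^+ 2 + l2 ^+ 2) * (l1 / (l1 ^+ 2 + l2 ^+ 2))) +
       b * (l1 / (l1 ^+ 2 + l2 ^+ 2) * (l1 / (l1 ^+ 2 + l2 ^+ 2)) -
            - l2 / (l1 ^+ 2 + l2 ^+ 2) * (- l2 / (l1 ^+ 2 + l2 ^+ 2)))).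
  by move=> ?; field.
move: Nx0; rewrite /N -!expr2 => Nx0.
split.
  apply: (is_derive_congr (is_deriveM fR dNV)).
    by move=> t; rewrite creV !expr2.
  rewrite !(creN, creM, cimM, creV, cimV) /N -!expr2; exact: keyR.
apply: (is_derive_congr (is_deriveM (is_deriveN fI) dNV)).
  by move=> t; rewrite cimV !expr2.
rewrite !(cimN, creM, cimM, creV, cimV) /N -!expr2; exact: keyI.
Qed.

End ScalarCalculus.

(** * Vector-valued functions through linear functionals *)

Section VectorCalculus.
Variable R : realType.
Notation C := R[i].

Section Functionals.
Variables (E : vectType C) (phi : E -> C).
Hypothesis phi_scalar : scalar phi.

Lemma functionalD u v : phi (u + v) = phi u + phi v.
Proof. by have := phi_scalar 1 u v; rewrite scale1r mul1r. Qed.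

Lemma functional0 : phi 0 = 0.
Proof. by apply: (@addrI _ (phi 0)); rewrite -functionalD !addr0. Qed.

Lemma functionalZ c v : phi (c *: v) = c * phi v.
Proof. by have := phi_scalar c v 0; rewrite functional0 !addr0. Qed.

Lemma functional_sum (I : Type) (r : seq I) (P : pred I) (F : I -> E) :
  phi (\sum_(i <- r | P i) F i) = \sum_(i <- r | P i) phi (F i).
Proof. by apply: (big_morph phi functionalD functional0). Qed.

End Functionals.

Section Coordinates.
Variable E : vectType C.
Implicit Types (F G : R -> E) (phi : E -> C) (x : R) (l v : E).

Lemma vcoord_scalar i : scalar (@vcoord R E i).
Proof. by move=> c u v; rewrite /vcoord linearP. Qed.

Lemma vcoordK v : \sum_i vcoord i v *: (vbasis {:E})`_i = v.
Proof. by rewrite [RHS](coord_vbasis (memvf v)). Qed.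

Lemma functional_vcoord phi v : scalar phi ->
  phi v = \sum_i vcoord i v * phi (vbasis {:E})`_i.
Proof.
move=> ps; rewrite -[in LHS](vcoordK v) functional_sum //.
by apply: eq_bigr => i _; rewrite functionalZ.
Qed.

(** Quantifying over all linear functionals, rather than over the coordinates
    in one basis, makes the notion stable under linear maps by mere
    composition; the coordinates suffice to establish it
    ([is_vderive_vcoord]). *)
Definition is_vderive F x l : Prop :=
  forall phi, scalar phi -> is_cderive (fun t => phi (F t)) x (phi l).

Lemma is_vderive_vcoord F x l :
  (forall i, is_cderive (fun t => vcoord i (F t)) x (vcoord i l)) ->
  is_vderive F x l.
Proof.
move=> dF phi ps; rewrite (functional_vcoord l ps).
under eq_fun do rewrite (functional_vcoord _ ps).
apply: is_cderive_sum => i.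
under eq_fun do rewrite mulrC.
by rewrite mulrC; exact: is_cderiveMl.
Qed.

Lemma is_vderive_vderive F x l : is_vderive F x l -> vderive F x = l.
Proof.
move=> dF; rewrite /vderive -[RHS]vcoordK; apply: eq_bigr => i _.
by rewrite (is_cderive_cderive (dF _ (vcoord_scalar i))).
Qed.

Lemma near_is_vderive F G x l : (\forall t \near x, F t = G t) ->
  is_vderive F x l -> is_vderive G x l.
Proof.
move=> FG dF phi ps; apply: near_is_cderive (dF phi ps).
by apply: filterS FG => t ->.
Qed.

Lemma is_vderiveZ (f : R -> C) F x (a : C) l :
  is_cderive f x a -> is_vderive F x l ->
  is_vderive (fun t => f t *: F t) x (a *: F x + f x *: l).
Proof.
move=> df dF phi ps; rewrite functionalD // !functionalZ //.
under eq_fun do rewrite functionalZ //.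
exact: is_cderiveM df (dF _ ps).
Qed.

Lemma is_vderive_cst v x : is_vderive (fun=> v) x 0.
Proof. by move=> phi ps; rewrite functional0 //; exact: is_cderive_cst. Qed.

End Coordinates.

(** The Leibniz rule: expanding the left factor in a basis turns a functional
    of the composite into a sum of products of scalar functions. *)
Lemma is_vderive_comp (V1 V2 V3 : vectType C) (F : R -> 'Hom(V2, V3))
    (G : R -> 'Hom(V1, V2)) x l1 l2 :
  is_vderive F x l1 -> is_vderive G x l2 ->
  is_vderive (fun t => F t \o G t)%VF x ((l1 \o G x)%VF + (F x \o l2)%VF).
Proof.
move=> dF dG phi ps.
have bilin (f : 'Hom(V2, V3)) (g : 'Hom(V1, V2)) :
    phi (f \o g)%VF = \sum_i vcoord i f * phi ((vbasis {:'Hom(V2, V3)})`_i \o g)%VF.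
  apply: (@functional_vcoord _ (fun f => phi (f \o g)%VF)).
  by move=> c u v; rewrite comp_lfunDl -comp_lfunZl ps.
rewrite functionalD // !bilin -big_split /=.
under eq_fun do rewrite bilin.
apply: is_cderive_sum => i; apply: is_cderiveM.
  exact: dF (vcoord_scalar _).
apply: (dG (fun g => phi (_ \o g)%VF)).
by move=> c u v; rewrite comp_lfunDr -comp_lfunZr ps.
Qed.

End VectorCalculus.

(** * The differential of the substitution action at the identity *)

Section SeparatingFunctionals.
Variables (K : fieldType) (E : vectType K) (I : finType) (e : I -> E -> K).
Hypothesis e_scalar : forall a, scalar (e a).
Hypothesis e_sep : forall v, (forall a, e a v = 0) -> v = 0.

(** A finite family of functionals that separates points spans the dual: it
    defines an injective linear map into a space of finite functions, and the
    given functional factors through a left inverse of that map. *)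
Lemma functional_separating (phi : E -> K) : scalar phi ->
  exists c : I -> K, forall v, phi v = \sum_a c a * e a v.
Proof.
move=> ps.
pose ev (v : E) : {ffun I -> K^o} := [ffun a => e a v].
have ev_linear : linear ev.
  by move=> c u v; apply/ffunP => a; rewrite !ffunE e_scalar.
pose evL : {linear E -> {ffun I -> K^o}} :=
  HB.pack ev (GRing.isLinear.Build K E {ffun I -> K^o} _ ev ev_linear).
pose phiL : {linear E -> K^o} :=
  HB.pack phi (GRing.isLinear.Build K E K^o _ phi ps).
pose L := linfun evL.
have LK : (L^-1 \o L)%VF = \1%VF.
  apply: lker0_compVf; apply/lker0P => u v.
  rewrite !lfunE /= => uv; apply/eqP; rewrite -subr_eq0; apply/eqP/e_sep => a.
  have := congr1 (fun f : {ffun I -> K^o} => f a) uv; rewrite !ffunE => euv.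
  by rewrite -scaleN1r addrC e_scalar euv mulN1r addNr.
pose delta a : {ffun I -> K^o} := [ffun b => (a == b)%:R].
exists (fun a => phi (L^-1%VF (delta a))) => v.
have -> : phi v = phiL (L^-1%VF (L v)).
  by have /(congr1 (fun f : 'End(E) => f v)) := LK; rewrite comp_lfunE id_lfunE => ->.
have -> : L v = \sum_a e a v *: delta a.
  rewrite lfunE; apply/ffunP => b; rewrite sum_ffunE ffunE (bigD1 b) //= big1 ?addr0.
    by rewrite !ffunE eqxx /GRing.scale /= mulr1.
  by move=> a /negPf ab; rewrite !ffunE ab scaler0.
rewrite !linear_sum; apply: eq_bigr => a _.
by rewrite !linearZ /= /GRing.scale /= mulrC.
Qed.

End SeparatingFunctionals.

Section DifferentialAtIdentity.
Variables (R : realType) (d : nat).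
Notation C := R[i].
Notation M := 'M[C]_d.+1.
Implicit Types (Phi Psi : M -> C) (T : M).

Definition curve_at1 (Z : R -> M) (x : R) (N : M) : Prop :=
  [/\ Z x = 1%:M, \forall t \near x, Z t \in unitmx
    & forall i j, is_cderive (fun t => Z t i j) x (N i j)].

(** A chain rule at the identity taken as a definition.  It asks for the
    derivative along every curve through the identity, with a value that is
    linear in the velocity, and it is closed under the operations from which
    the coefficients of the substitution action are built. *)
Definition diff_at1 Phi : Prop :=
  exists2 D : M -> C, scalar D &
    forall Z x N, curve_at1 Z x N -> is_cderive (fun t => Phi (Z t)) x (D N).

Lemma diff_at1_eq Phi Psi : (forall T, T \in unitmx -> Phi T = Psi T) ->
  diff_at1 Phi -> diff_at1 Psi.
Proof.
move=> PP [D sD dD]; exists D => // Z x N ZN.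
case: (ZN) => _ uZ _; apply: near_is_cderive (dD _ _ _ ZN).
by apply: filterS uZ => t; exact: PP.
Qed.

Lemma diff_at1_cst c : diff_at1 (fun=> c).
Proof.
exists (fun=> 0) => [a u v|Z x N _]; first by rewrite mulr0 addr0.
exact: is_cderive_cst.
Qed.

Lemma diff_at1_entry i j : diff_at1 (fun T => T i j).
Proof. by exists (fun N => N i j) => [a u v|Z x N []] //; rewrite !mxE. Qed.

Lemma diff_at1D Phi Psi : diff_at1 Phi -> diff_at1 Psi ->
  diff_at1 (fun T => Phi T + Psi T).
Proof.
move=> [D sD dD] [D' sD' dD']; exists (fun N => D N + D' N) => [a u v|Z x N ZN].
  by rewrite sD sD'; ring.
exact: is_cderiveD (dD _ _ _ ZN) (dD' _ _ _ ZN).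
Qed.

Lemma diff_at1M Phi Psi : diff_at1 Phi -> diff_at1 Psi ->
  diff_at1 (fun T => Phi T * Psi T).
Proof.
move=> [D sD dD] [D' sD' dD'].
exists (fun N => D N * Psi 1%:M + Phi 1%:M * D' N) => [a u v|Z x N ZN].
  by rewrite sD sD'; ring.
have [<- _ _] := ZN.
exact: (is_cderiveM (dD _ _ _ ZN) (dD' _ _ _ ZN)).
Qed.

Lemma diff_at1V Phi : Phi 1%:M != 0 -> diff_at1 Phi ->
  diff_at1 (fun T => (Phi T)^-1).
Proof.
move=> Phi1 [D sD dD].
exists (fun N => - D N / Phi 1%:M ^+ 2) => [a u v|Z x N ZN].
  by rewrite sD; ring.
have [Z1 _ _] := ZN; rewrite -Z1.
by apply: (is_cderiveV (dD _ _ _ ZN)); rewrite Z1.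
Qed.

Lemma diff_at1_sum (I : Type) (r : seq I) (P : pred I) (F : I -> M -> C) :
  (forall i, diff_at1 (F i)) -> diff_at1 (fun T => \sum_(i <- r | P i) F i T).
Proof.
move=> dF; elim: r => [|i r IHr].
  by under eq_fun do rewrite big_nil; exact: diff_at1_cst.
under eq_fun do rewrite big_cons.
by case: (P i) => //; exact: diff_at1D.
Qed.

Lemma diff_at1_prod (I : Type) (r : seq I) (P : pred I) (F : I -> M -> C) :
  (forall i, diff_at1 (F i)) -> diff_at1 (fun T => \prod_(i <- r | P i) F i T).
Proof.
move=> dF; elim: r => [|i r IHr].
  by under eq_fun do rewrite big_nil; exact: diff_at1_cst.
under eq_fun do rewrite big_cons.
by case: (P i) => //; exact: diff_at1M.
Qed.

Lemma diff_at1_det m (H : M -> 'M[C]_m) :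
  (forall i j, diff_at1 (fun T => H T i j)) -> diff_at1 (fun T => \det (H T)).
Proof.
move=> dH; apply: diff_at1_sum => s; apply: diff_at1M; first exact: diff_at1_cst.
exact: diff_at1_prod.
Qed.

(** By Cramer's rule: curves through the identity stay invertible near it,
    and there the inverse is the adjugate over the determinant. *)
Lemma diff_at1_invmx i j : diff_at1 (fun T => invmx T i j).
Proof.
apply: (@diff_at1_eq (fun T => (\det T)^-1 * \adj T i j)).
  by move=> T uT; rewrite /invmx uT !mxE.
apply: diff_at1M.
  apply: diff_at1V; first by rewrite det1 oner_eq0.
  by apply: (@diff_at1_det _ id) => k l; exact: diff_at1_entry.
under eq_fun do rewrite mxE.
apply: diff_at1M; first exact: diff_at1_cst.
apply: diff_at1_det => k l; under eq_fun do rewrite !mxE.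
exact: diff_at1_entry.
Qed.

Definition coeff_diff_at1 (G : M -> mpoly d.+1 C) : Prop :=
  forall m, diff_at1 (fun T => mcoeff m (G T)).

Lemma coeff_diff_at1_sum (I : Type) (r : seq I) (F : I -> M -> mpoly d.+1 C) :
  (forall i, coeff_diff_at1 (F i)) -> coeff_diff_at1 (fun T => \sum_(i <- r) F i T).
Proof.
move=> dF m; under eq_fun do rewrite raddf_sum /=.
by apply: diff_at1_sum => i; exact: dF.
Qed.

Lemma coeff_diff_at1Z Phi (G : M -> mpoly d.+1 C) :
  diff_at1 Phi -> coeff_diff_at1 G -> coeff_diff_at1 (fun T => Phi T *: G T).
Proof.
by move=> dP dG m; under eq_fun do rewrite mcoeffZ; exact: diff_at1M.
Qed.

Lemma coeff_diff_at1_cst p : coeff_diff_at1 (fun=> p).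
Proof. by move=> m; exact: diff_at1_cst. Qed.

Lemma coeff_diff_at1M (F G : M -> mpoly d.+1 C) :
  coeff_diff_at1 F -> coeff_diff_at1 G -> coeff_diff_at1 (fun T => F T * G T).
Proof.
move=> dF dG m; under eq_fun do rewrite mcoeffM.
by apply: diff_at1_sum => k; apply: diff_at1M.
Qed.

Lemma coeff_diff_at1_exp (F : M -> mpoly d.+1 C) k :
  coeff_diff_at1 F -> coeff_diff_at1 (fun T => F T ^+ k).
Proof.
move=> dF; elim: k => [|k IHk]; first exact: coeff_diff_at1_cst.
by under eq_fun do rewrite exprS; exact: coeff_diff_at1M.
Qed.

Lemma coeff_diff_at1_prod (I : Type) (r : seq I) (F : I -> M -> mpoly d.+1 C) :
  (forall i, coeff_diff_at1 (F i)) -> coeff_diff_at1 (fun T => \prod_(i <- r) F i T).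
Proof.
move=> dF; elim: r => [|i r IHr].
  by under eq_fun do rewrite big_nil; exact: coeff_diff_at1_cst.
by under eq_fun do rewrite big_cons; exact: coeff_diff_at1M.
Qed.

Lemma coeff_diff_at1_subst p :
  coeff_diff_at1 (fun T => comp_mpoly (linear_forms T) p).
Proof.
under eq_fun do rewrite comp_mpolyEX.
apply: coeff_diff_at1_sum => m.
apply: coeff_diff_at1Z; first exact: diff_at1_cst.
under eq_fun do rewrite comp_mpolyX.
apply: coeff_diff_at1_prod => i; apply: coeff_diff_at1_exp.
under eq_fun do rewrite tnth_mktuple.
apply: coeff_diff_at1_sum => j; apply: coeff_diff_at1Z.
  exact: diff_at1_entry.
exact: coeff_diff_at1_cst.
Qed.

Section ConjSubst.
Variable n : nat.
Notation V := (hvect C d n).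

(** The coefficient of a monomial in one component of the image of one basis
    vector.  Monomials of degree at most n suffice, which keeps the family
    finite. *)
Definition coeff_functional
    (a : 'I_(\dim {:V}) * 'I_d.+1 * bmultinom d.+1 n.+1) (f : 'End(V)) : C :=
  mcoeff (bmnm a.2) (mpoly_of_dhomog ((f (vbasis {:V})`_a.1.1 : {ffun _ -> _}) a.1.2)).

Lemma coeff_functional_scalar a : scalar (coeff_functional a).
Proof.
move=> c f g; rewrite /coeff_functional add_lfunE scale_lfunE !ffunE.
by rewrite linearP.
Qed.

Lemma coeff_functional_sep f : (forall a, coeff_functional a f = 0) -> f = 0.
Proof.
move=> f0; apply/lfunP => v; rewrite lfunE /= -(vcoordK v) linear_sum big1 // => k _.
rewrite linearZ /= [f _](_ : _ = 0) ?scaler0 //.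
apply/ffunP => i; rewrite ffunE; apply/val_inj/mpolyP => m; rewrite mcoeff0.
have [mn|mn] := eqVneq (mdeg m) n; last first.
  by apply: (@dhomog_nemf_coeff _ _ mdeg n) => //; exact: dhomog_is_dhomog.
have mlt : (mdeg m < n.+1)%N by rewrite mn.
exact: (f0 (k, i, BMultinom mlt)).
Qed.

(** Every functional of the operator is a combination of monomial
    coefficients, which are polynomial in the entries of T and of its
    inverse. *)
Lemma conj_subst_differential :
  exists2 D : M -> 'End(V), linear D &
    forall Z x N, curve_at1 Z x N ->
      is_vderive (fun t => conj_subst n (Z t)) x (D N).
Proof.
have dphi phi : scalar phi -> diff_at1 (fun T => phi (conj_subst n T)).
  move=> ps.
  have [c phiE] := functional_separating coeff_functional_scalar
    coeff_functional_sep ps.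
  under eq_fun do rewrite phiE.
  apply: diff_at1_sum => a; apply: diff_at1M; first exact: diff_at1_cst.
  rewrite /coeff_functional.
  under eq_fun do rewrite conj_substE ffunE !raddf_sum /=.
  apply: diff_at1_sum => j.
  under eq_fun do rewrite mcoeffZ.
  apply: diff_at1M; first exact: diff_at1_invmx.
  exact: coeff_diff_at1_subst.
have /choice [D HD] i : exists D : M -> C, scalar D /\
    forall Z x N, curve_at1 Z x N ->
      is_cderive (fun t => vcoord i (conj_subst n (Z t))) x (D N).
  by have [D sD dD] := dphi _ (@vcoord_scalar R _ i); exists D.
exists (fun N => \sum_i D i N *: (vbasis {:'End(V)})`_i).
  move=> c u v; rewrite scaler_sumr -big_split; apply: eq_bigr => i _ /=.
  by have [-> _] := HD i; rewrite scalerDl scalerA.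
move=> Z x N ZN; apply: is_vderive_vcoord => i.
have [_ dD] := HD i; rewrite /vcoord coord_sum_free; first exact: dD.
exact: basis_free (vbasisP _).
Qed.

End ConjSubst.
End DifferentialAtIdentity.

(** * The differential equation of the weight *)

Section Substitution.
Variables (K : fieldType) (d n : nat).
Implicit Types T S : 'M[K]_d.+1.

Lemma comp_linear_forms S T (p : mpoly d.+1 K) :
  comp_mpoly (linear_forms S) (comp_mpoly (linear_forms T) p) =
  comp_mpoly (linear_forms (T *m S)) p.
Proof.
rewrite (comp_mpolyEX p (linear_forms T)) linear_sum [RHS]comp_mpolyEX; apply: eq_bigr => m _.
rewrite linearZ /= !comp_mpolyX rmorph_prod; congr (_ *: _).
apply: eq_bigr => i _; rewrite rmorphXn /=; congr (_ ^+ _).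
rewrite !tnth_mktuple linear_sum.
under eq_bigr do rewrite linearZ /= comp_mpolyXU -tnth_nth tnth_mktuple scaler_sumr.
rewrite exchange_big; apply: eq_bigr => k _ /=.
by rewrite mxE scaler_suml; apply: eq_bigr => j _; rewrite scalerA.
Qed.

Lemma hsubst_mul S T (p : dhomog d.+1 K n) :
  hsubst S (hsubst T p) = hsubst (T *m S) p.
Proof. by apply/val_inj; rewrite /= comp_linear_forms. Qed.

Lemma hsubst_linear S : linear (@hsubst K d n S).
Proof. by move=> a p q; apply/val_inj; rewrite /= linearP. Qed.

HB.instance Definition _ S :=
  GRing.isLinear.Build K (dhomog d.+1 K n) (dhomog d.+1 K n) _ (@hsubst K d n S)
    (hsubst_linear S).

Lemma hsubst1 (p : dhomog d.+1 K n) : hsubst 1%:M p = p.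
Proof.
apply/val_inj; rewrite /= -[RHS]comp_mpoly_id; congr comp_mpoly.
apply: eq_from_tnth => i; rewrite !tnth_mktuple (bigD1 i) //= big1 ?addr0.
  by rewrite mxE eqxx scale1r.
by move=> j; rewrite eq_sym mxE => /negPf ->; rewrite scale0r.
Qed.

Lemma conj_subst1 : conj_subst n (1%:M : 'M[K]_d.+1) = \1%VF.
Proof.
apply/lfunP => q; rewrite conj_substE id_lfunE; apply/ffunP => i.
rewrite ffunE invmx1 (bigD1 i) //= big1 ?addr0.
  by rewrite mxE eqxx scale1r hsubst1.
by move=> j; rewrite eq_sym mxE => /negPf ->; rewrite scale0r.
Qed.

(** The inner matrix acts last on the variables but first on the values, so
    the order of the factors is reversed. *)
Lemma conj_subst_mul T S : T \in unitmx -> S \in unitmx ->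
  conj_subst n (T *m S) = (conj_subst n S \o conj_subst n T)%VF.
Proof.
move=> uT uS; apply/lfunP => q; rewrite comp_lfunE !conj_substE.
apply/ffunP => i; rewrite !ffunE.
under [RHS]eq_bigr do rewrite ffunE linear_sum scaler_sumr.
rewrite exchange_big; apply: eq_bigr => k _ /=.
have -> : invmx (T *m S) = invmx S *m invmx T.
  have uTS : T *m S \in unitmx by rewrite unitmx_mul uT.
  apply: (can_inj (mulmxK uTS)).
  by rewrite mulVmx // -mulmxA (mulmxA (invmx T)) mulVmx // mul1mx mulVmx.
rewrite mxE scaler_suml; apply: eq_bigr => j _.
by rewrite linearZ /= scalerA hsubst_mul.
Qed.

Lemma conj_subst_inv T : T \in unitmx ->
  ((conj_subst n T)^-1 \o conj_subst n T)%VF = \1%VF.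
Proof.
move=> uT; apply: lker0_compVf; apply/lker0P => u v uv.
have LK : (conj_subst n (invmx T) \o conj_subst n T)%VF = \1%VF.
  by rewrite -conj_subst_mul ?unitmx_inv // mulmxV // conj_subst1.
have E w : conj_subst n (invmx T) (conj_subst n T w) = w.
  by rewrite -comp_lfunE LK id_lfunE.
by rewrite -[u]E uv E.
Qed.

End Substitution.

Section WeightDerivative.
Variables (R : realType) (d n : nat) (A B : 'M[R[i]]_d.+1) (Y : R -> 'M[R[i]]_d.+1).
Hypothesis Y_fund : fundamental_matrix A B Y.
Notation E := 'End(hvect R[i] d n).

Lemma curve_at1_fundamental x : x \in `]-1, 1[%R ->
  curve_at1 (fun t => Y t *m invmx (Y x)) x (system_matrix A B x).
Proof.
move=> xI; have YI (t : R) : t \in `]-1, 1[%R -> Y t \in unitmx.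
  by move=> tI; case: (@Y_fund t); rewrite ?inE.
split; first by rewrite mulmxV // YI.
  apply: filterS (near_itv11 xI) => t tI.
  by rewrite unitmx_mul unitmx_inv !YI.
move=> i j; have [|dY _] := @Y_fund x; first by rewrite inE.
have -> : system_matrix A B x = system_matrix A B x *m Y x *m invmx (Y x).
  by rewrite mulmxK // YI.
rewrite mxE; under eq_fun do rewrite mxE.
apply: is_cderive_sum => k.
under eq_fun do rewrite mulrC.
by rewrite mulrC; exact: is_cderiveMl.
Qed.

(** Near x the weight is the constant W(x) composed with the action of a
    curve that passes through the identity with velocity M(x); NA and NB are
    the values at A and B of the differential of the action. *)
Lemma weight_derivative : exists NA NB : E, forall x, x \in `]-1, 1[%R ->
  is_vderive (weight n Y) x
    (weight n Y x \o (((x - 1)^-1)%:C *: NA + ((x + 1)^-1)%:C *: NB))%VF.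
Proof.
have [D lD dD] := conj_subst_differential R d n.
exists (D A), (D B) => x xI.
have DZ a u : D (a *: u) = a *: D u.
  have D0 : D 0 = 0 by apply: (@addrI _ (D 0)); rewrite -{1}[D 0]scale1r -lD scaler0 !addr0.
  by have := lD a u 0; rewrite D0 !addr0.
have <- : D (system_matrix A B x) = ((x - 1)^-1)%:C *: D A + ((x + 1)^-1)%:C *: D B.
  by rewrite /system_matrix lD DZ.
have YI (t : R) : t \in `]-1, 1[%R -> Y t \in unitmx.
  by move=> tI; case: (@Y_fund t); rewrite ?inE.
have ZN := curve_at1_fundamental xI.
have := is_vderive_comp (is_vderive_cst (weight n Y x) x) (dD _ _ _ ZN).
rewrite comp_lfun0l add0r; apply: near_is_vderive.
apply: filterS (near_itv11 xI) => t tI.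
by rewrite -conj_subst_mul ?unitmx_mul ?unitmx_inv ?YI // mulmxKV // YI.
Qed.

End WeightDerivative.

(** * Operator polynomials and the Rodrigues formula *)

Section OperatorPolynomials.
Variables (R : realType) (V : vectType R[i]).
Notation E := 'End(V).
Implicit Types (S T : R -> E) (L : E).

(** Operator-valued polynomials of degree less than n. *)
Definition opoly (n : nat) S : Prop :=
  exists c : nat -> E, forall x, S x = \sum_(a < n) (x ^+ a)%:C *: c a.

Lemma opoly_ext n S T : S =1 T -> opoly n S -> opoly n T.
Proof. by move=> ST [c Sc]; exists c => x; rewrite -ST. Qed.

Lemma opoly_cst L : opoly 1 (fun=> L).
Proof. by exists (fun=> L) => x; rewrite big_ord1 expr0 scale1r. Qed.

Lemma opoly_widen m n S : (m <= n)%N -> opoly m S -> opoly n S.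
Proof.
move=> mn [c Sc]; exists (fun a => if (a < m)%N then c a else 0) => x.
rewrite Sc (big_ord_widen n (fun a => (x ^+ a)%:C *: c a) mn) big_mkcond.
by apply: eq_bigr => a _; case: ifP => // _; rewrite scaler0.
Qed.

Lemma opolyD n S T : opoly n S -> opoly n T -> opoly n (fun x => S x + T x).
Proof.
move=> [c Sc] [c' Tc]; exists (fun a => c a + c' a) => x.
by rewrite Sc Tc -big_split; apply: eq_bigr => a _; rewrite scalerDr.
Qed.

Lemma opolyX n S : opoly n S -> opoly n.+1 (fun x => x%:C *: S x).
Proof.
move=> [c Sc]; exists (fun a => if a is a'.+1 then c a' else 0) => x.
rewrite Sc big_ord_recl scaler0 add0r scaler_sumr; apply: eq_bigr => a _ /=.
by rewrite scalerA -rmorphM /= -exprS.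
Qed.

Lemma opoly_comp n L S : opoly n S -> opoly n (fun x => L \o S x)%VF.
Proof.
move=> [c Sc]; exists (fun a => L \o c a)%VF => x.
rewrite Sc; apply/lfunP => v.
rewrite comp_lfunE !sum_lfunE linear_sum; apply: eq_bigr => a _.
by rewrite !scale_lfunE linearZ /= comp_lfunE.
Qed.

Lemma opolyZ n (z : R[i]) S : opoly n S -> opoly n (fun x => z *: S x).
Proof.
move=> [c Sc]; exists (fun a => z *: c a) => x.
by rewrite Sc scaler_sumr; apply: eq_bigr => a _; rewrite !scalerA mulrC.
Qed.

Lemma opoly_derive n S : opoly n.+1 S ->
  exists2 S', opoly n S' & forall x, is_vderive S x (S' x).
Proof.
move=> [c Sc]; exists (fun x => \sum_(a < n) (x ^+ a)%:C *: (a.+1%:R *: c a.+1)).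
  by exists (fun a => a.+1%:R *: c a.+1).
move=> x phi ps; rewrite functional_sum //.
under eq_fun do rewrite Sc functional_sum // big_ord_recl expr0 scale1r.
rewrite -[X in is_cderive _ _ X]add0r; apply: is_cderiveD.
  exact: is_cderive_cst.
apply: is_cderive_sum => a.
under eq_fun do rewrite functionalZ // mulrC.
have -> : phi ((x ^+ a)%:C *: (a.+1%:R *: c a.+1)) =
    phi (c a.+1) * ((x ^+ a)%:C * a.+1%:R).
  by rewrite !functionalZ //; ring.
apply: is_cderiveMl.
have -> : (x ^+ a)%:C * a.+1%:R = (a.+1%:R * x ^+ a)%:C.
  by rewrite rmorphM /= rmorph_nat mulrC.
apply: is_cderive_real.
apply: (is_derive_congr (is_deriveX a.+1 (is_derive_id x 1))) => [t|].
  by rewrite exprfctE lift0.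
exact: mulr1.
Qed.

End OperatorPolynomials.

Section Rodrigues.
Variables (R : realType) (V : vectType R[i]).
Notation E := 'End(V).
Variables (W : R -> E) (NA NB : E).
Notation N x := (((x - 1)^-1)%:C *: NA + ((x + 1)^-1)%:C *: NB).
Hypothesis W_ode : forall x : R, x \in `]-1, 1[%R ->
  is_vderive W x (W x \o N x)%VF.
Implicit Types (S T F G : R -> E).

Lemma is_derive_Qpoly (x : R) m :
  is_derive x 1 (fun t => Qpoly t ^+ m.+1) (Qpoly x ^+ m * (m.+1%:R * (2 * x))).
Proof.
have dQ : is_derive x 1 (@Qpoly R) (2 * x).
  apply: (is_derive_congr (is_deriveB (is_deriveX 2 (is_derive_id x 1))
    (is_derive_cst (1 : R) x 1))) => [t|]; first by rewrite fctE exprfctE.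
  by rewrite subr0; exact: mulr1.
apply: (is_derive_congr (is_deriveX m.+1 dQ)) => [t|]; first by rewrite exprfctE.
by rewrite [LHS](_ : _ = m.+1%:R * Qpoly x ^+ m * (2 * x)) //; ring.
Qed.

(** One power of Q absorbs the poles of W' = W N: the polynomial T is
    Q N S + (m + 1) Q' S + Q S', where Q N has degree at most 1. *)
Lemma rodrigues_step n m S : opoly n.+1 S ->
  exists2 T, opoly n.+2 T & forall x : R, x \in `]-1, 1[%R ->
    is_vderive (fun t => (Qpoly t ^+ m.+1)%:C *: (W t \o S t)%VF) x
      ((Qpoly x ^+ m)%:C *: (W x \o T x)%VF).
Proof.
move=> oS; have [S' oS' dS] := opoly_derive oS.
(* QN is Q times the coefficient of the differential equation. *)
pose QN x := (x + 1)%:C *: NA + (x - 1)%:C *: NB.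
exists (fun x => (QN x \o S x)%VF + (m.+1%:R * (2 * x))%:C *: S x +
                 (Qpoly x)%:C *: S' x).
  have oQN : opoly n.+2 (fun x => (QN x \o S x)%VF).
    apply: (opoly_ext _ (opolyD (opolyX (opoly_comp (NA + NB) oS))
      (opoly_widen (leqnSn _) (opoly_comp (NA - NB) oS)))) => x /=.
    rewrite /QN comp_lfunZl -comp_lfunDl; congr (_ \o _)%VF.
    rewrite rmorphD rmorphB rmorph1 !scalerDl !scalerDr scaleN1r !scale1r.
    by rewrite addrACA.
  have oxS : opoly n.+2 (fun x => (m.+1%:R * (2 * x))%:C *: S x).
    apply: (opoly_ext _ (opolyZ (m.+1%:R * 2) (opolyX oS))) => x /=.
    by rewrite scalerA !rmorphM /= !rmorph_nat mulrA.
  have oQS' : opoly n.+2 (fun x => (Qpoly x)%:C *: S' x).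
    apply: (opoly_ext _ (opolyD (opolyX (opolyX oS'))
      (opoly_widen (leq_trans (leqnSn _) (leqnSn _)) (opolyZ (-1) oS')))) => x /=.
    by rewrite /Qpoly rmorphB rmorph1 scalerBl scale1r scaleN1r scalerA expr2 rmorphM.
  exact: opolyD (opolyD oQN oxS) oQS'.
move=> x xI.
have QNE : QN x = (Qpoly x)%:C *: N x.
  have [x1 x2] : x - 1 != 0 /\ x + 1 != 0.
    move: xI; rewrite in_itv /= => /andP[x1 x2]; split.
      by rewrite subr_eq0 lt_eqF.
    by rewrite addr_eq0 gt_eqF.
  rewrite /QN scalerDr !scalerA -!rmorphM /= /Qpoly.
  by congr (_%:C *: _ + _%:C *: _); field.
have := is_vderiveZ (is_cderive_real (is_derive_Qpoly x m))
  (is_vderive_comp (W_ode xI) (dS x)).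
congr (is_vderive _ _ _); move: (N x) QNE => Nx QNE.
rewrite exprS !rmorphM /= !comp_lfunDr !scalerDr.
rewrite -!comp_lfunZr QNE -comp_lfunZl -comp_lfunZr comp_lfunA.
by rewrite !scalerA [(Qpoly x)%:C * _]mulrC addrCA addrA.
Qed.

Definition QW k (t : R) := (Qpoly t ^+ k)%:C *: W t.

Lemma rodrigues_derivative k i : (i <= k)%N ->
  exists2 S, opoly i.+1 S & forall x : R, x \in `]-1, 1[%R ->
    vderiven i (QW k) x = (Qpoly x ^+ (k - i))%:C *: (W x \o S x)%VF.
Proof.
elim: i => [_|i IHi ik].
  exists (fun=> \1%VF); first exact: opoly_cst.
  by move=> x xI; rewrite subn0 comp_lfun1r.
have [S oS SE] := IHi (ltnW ik).
have [T oT dT] := rodrigues_step (k - i.+1) oS.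
exists T => // x xI; apply: is_vderive_vderive.
apply: near_is_vderive (dT x xI).
by apply: filterS (near_itv11 xI) => t tI; rewrite subnSK //; exact/esym/SE.
Qed.

Lemma rodrigues_derivable k i (x : R) : (i < k)%N -> x \in `]-1, 1[%R ->
  is_vderive (vderiven i (QW k)) x (vderiven i.+1 (QW k) x).
Proof.
move=> ik xI; have [S oS SE] := rodrigues_derivative (ltnW ik).
have [T _ dT] := rodrigues_step (k - i.+1) oS.
have dF : is_vderive (vderiven i (QW k)) x
    ((Qpoly x ^+ (k - i.+1))%:C *: (W x \o T x)%VF).
  apply: near_is_vderive (dT x xI).
  by apply: filterS (near_itv11 xI) => t tI; rewrite SE // subnSK.
have E : vderiven i.+1 (QW k) x = _ := is_vderive_vderive dF.
by rewrite E.
Qed.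

End Rodrigues.

(** * Moments of the derivatives and quasi-orthogonality *)

Section ComplexIntegral.
Variable R : realType.
Notation C := R[i].
Notation mu := (@lebesgue_measure R).
Variable D : set R.
Hypothesis mD : measurable (D : set (measurableTypeR R)).
Implicit Types (f g : R -> C) (c : C).

Lemma integrable_congr (f g : R -> R) : {in D, f =1 g} ->
  mu.-integrable D (EFin \o f) -> mu.-integrable D (EFin \o g).
Proof. by move=> fg; apply: eq_integrable => // x xD; rewrite /= fg. Qed.

Lemma cintegrable_congr f g :
  {in D, f =1 g} -> cintegrable D f -> cintegrable D g.
Proof.
by move=> fg [fR fI]; split; [apply: integrable_congr fR|apply: integrable_congr fI]
  => x xD; rewrite fg.
Qed.

Lemma eq_cintegral f g : {in D, f =1 g} -> cintegral D f = cintegral D g.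
Proof.
by move=> fg; rewrite /cintegral; congr (_ +i* _);
  apply: eq_Rintegral => x xD; rewrite fg.
Qed.

Lemma cintegrable0 : cintegrable D (fun=> 0).
Proof. by split; exact: integrable0. Qed.

Lemma cintegral0 : cintegral D (fun=> 0) = 0.
Proof. by rewrite /cintegral Rintegral_cst // mul0r. Qed.

Lemma cintegrableD f g : cintegrable D f -> cintegrable D g ->
  cintegrable D (fun x => f x + g x).
Proof.
move=> [fR fI] [gR gI]; split.
  by apply: (eq_integrable mD _ _ _ (integrableD mD fR gR)) => x _ /=; rewrite creD.
by apply: (eq_integrable mD _ _ _ (integrableD mD fI gI)) => x _ /=; rewrite cimD.
Qed.

Lemma cintegralD f g : cintegrable D f -> cintegrable D g ->
  cintegral D (fun x => f x + g x) = cintegral D f + cintegral D g.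
Proof.
move=> [fR fI] [gR gI]; rewrite /cintegral; apply/eqP; rewrite eq_complex /=.
by rewrite -!RintegralD //; apply/andP; split; apply/eqP;
  apply: eq_Rintegral => x _; rewrite ?creD ?cimD.
Qed.

Lemma cintegrableMl c f : cintegrable D f -> cintegrable D (fun x => c * f x).
Proof.
move=> [fR fI]; split.
  apply: (eq_integrable mD _ _ _ (integrableB mD (integrableZl mD (complex.Re c) fR)
    (integrableZl mD (complex.Im c) fI))) => x _.
  by cbv beta; rewrite creM.
apply: (eq_integrable mD _ _ _ (integrableD mD (integrableZl mD (complex.Re c) fI)
  (integrableZl mD (complex.Im c) fR))) => x _.
by cbv beta; rewrite cimM.
Qed.

Lemma cintegralMl c f : cintegrable D f ->
  cintegral D (fun x => c * f x) = c * cintegral D f.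
Proof.
move=> [fR fI]; rewrite /cintegral; apply/eqP; rewrite eq_complex.
rewrite creM cimM /= -!RintegralZl // -RintegralB //; last 2 first.
- exact: (integrableZl mD (complex.Re c) fR).
- exact: (integrableZl mD (complex.Im c) fI).
rewrite -RintegralD //; last 2 first.
- exact: (integrableZl mD (complex.Re c) fI).
- exact: (integrableZl mD (complex.Im c) fR).
by apply/andP; split; apply/eqP; apply: eq_Rintegral => x _; rewrite ?creM ?cimM.
Qed.

Lemma cintegrable_sum (J : Type) (r : seq J) (F : J -> R -> C) :
  (forall j, cintegrable D (F j)) -> cintegrable D (fun x => \sum_(j <- r) F j x).
Proof.
move=> iF; elim: r => [|j r IHr].
  by under eq_fun do rewrite big_nil; exact: cintegrable0.
by under eq_fun do rewrite big_cons; exact: cintegrableD.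
Qed.

Lemma cintegral_sum (J : Type) (r : seq J) (F : J -> R -> C) :
  (forall j, cintegrable D (F j)) ->
  cintegral D (fun x => \sum_(j <- r) F j x) = \sum_(j <- r) cintegral D (F j).
Proof.
move=> iF; elim: r => [|j r IHr].
  by rewrite big_nil; under eq_fun do rewrite big_nil; exact: cintegral0.
rewrite big_cons -IHr -cintegralD //; last exact: cintegrable_sum.
by congr cintegral; apply/funext => x; rewrite big_cons.
Qed.

Lemma cintegrable_power f a : D `<=` `[-1, 1] -> cintegrable D f ->
  cintegrable D (fun x => (x ^+ a)%:C * f x).
Proof.
move=> D1 [fR fI].
have mp : measurable_fun D (fun x : R => x ^+ a).
  exact: exprn_measurable.
have bp : [bounded x ^+ a : R | x in D].
  exists 1; split => // M M1 x Dx; apply: le_trans (ltW M1).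
  rewrite /= normrX exprn_ile1 // ler_norml.
  by have := D1 x Dx; rewrite /= in_itv.
split.
  apply: (eq_integrable mD _ _ _ (integrableMr mD mp bp fR)) => x _.
  by cbv beta; rewrite creM /= mul0r subr0.
apply: (eq_integrable mD _ _ _ (integrableMr mD mp bp fI)) => x _ /=.
by rewrite cimM /= mul0r addr0.
Qed.

End ComplexIntegral.

Section QuasiOrthogonality.
Variables (R : realType) (V : vectType R[i]).
Notation E := 'End(V).
Variables (W : R -> E) (NA NB : E).
Hypothesis W_ode : forall x : R, x \in `]-1, 1[%R ->
  is_vderive W x
    (W x \o (((x - 1)^-1)%:C *: NA + ((x + 1)^-1)%:C *: NB))%VF.
Hypothesis W_int : vintegrable `]-1, 1[ W.
Implicit Types (S T F G : R -> E).
Notation I := (`]-1, 1[%classic : set R).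

Let I_itv x : x \in I -> x \in `]-1, 1[%R.
Proof. by rewrite inE. Qed.

(** The space stable under all operations of the proof.  Its members are
    integrable when W is, and Q times a member is differentiable with a
    derivative in the space. *)
Definition weighted_poly F : Prop := exists n S, opoly n S /\
  forall x : R, x \in `]-1, 1[%R -> F x = (W x \o S x)%VF.

Lemma weighted_polyD F G : weighted_poly F -> weighted_poly G ->
  weighted_poly (fun x => F x + G x).
Proof.
move=> [n [S [oS FE]]] [m [T [oT GE]]].
exists (maxn n m), (fun x => S x + T x); split.
  by apply: opolyD; [apply: opoly_widen oS|apply: opoly_widen oT];
    rewrite ?leq_maxl ?leq_maxr.
by move=> x xI; rewrite FE // GE // comp_lfunDr.
Qed.

Lemma weighted_polyZ z F : weighted_poly F -> weighted_poly (fun x => z *: F x).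
Proof.
move=> [n [S [oS FE]]]; exists n, (fun x => z *: S x); split; first exact: opolyZ.
by move=> x xI; rewrite FE // comp_lfunZr.
Qed.

Lemma weighted_polyX a F : weighted_poly F ->
  weighted_poly (fun x => (x ^+ a)%:C *: F x).
Proof.
move=> wF; elim: a => [|a [n [S [oS FE]]]].
  by move: wF => [n [S [oS FE]]]; exists n, S; split => // x xI; rewrite scale1r FE.
exists n.+1, (fun x => x%:C *: S x); split; first exact: opolyX.
by move=> x xI; rewrite exprS rmorphM -scalerA FE // comp_lfunZr.
Qed.

Lemma weighted_polyQ m F : weighted_poly F ->
  weighted_poly (fun x => (Qpoly x ^+ m)%:C *: F x).
Proof.
move=> wF; elim: m => [|m wFm].
  by move: wF => [n [S [oS FE]]]; exists n, S; split => // x xI; rewrite scale1r FE.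
have [n [S [oS FE]]] := weighted_polyD (weighted_polyX 2 wFm) (weighted_polyZ (-1) wFm).
exists n, S; split => // x xI; rewrite -FE //.
by rewrite exprS rmorphM -scalerA rmorphB rmorph1 scalerBl scale1r scaleN1r.
Qed.

Lemma weighted_poly_integrable F phi : weighted_poly F -> scalar phi ->
  cintegrable I (fun x => phi (F x)).
Proof.
move=> [n [S [[c SE] FE]]] ps.
apply: (@cintegrable_congr _ _ _ (fun x : R => \sum_(a < n) (x ^+ a)%:C *
    \sum_(i < \dim {:E}) phi ((vbasis {:E})`_i \o c a)%VF * vcoord i (W x))) => //.
  move=> x /I_itv xI; rewrite FE // SE.
  rewrite [(_ \o _)%VF](_ : _ = \sum_(a < n) (x ^+ a)%:C *: (W x \o c a)%VF).
    rewrite functional_sum //; apply: eq_bigr => a _; rewrite functionalZ //.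
    congr (_ * _); rewrite (@functional_vcoord _ _ (fun f => phi (f \o c a)%VF)).
      by apply: eq_bigr => i _; rewrite mulrC.
    by move=> z u v; rewrite comp_lfunDl -comp_lfunZl ps.
  apply/lfunP => v; rewrite comp_lfunE !sum_lfunE linear_sum.
  by apply: eq_bigr => a _; rewrite !scale_lfunE linearZ /= comp_lfunE.
apply: cintegrable_sum => // a; apply: cintegrable_power => //.
  exact: subset_itv_oo_cc.
by apply: cintegrable_sum => // i; apply: cintegrableMl => //; exact: W_int.
Qed.

Lemma weighted_poly_derivable F (x : R) : weighted_poly F -> x \in `]-1, 1[%R ->
  exists l, is_vderive F x l.
Proof.
move=> [n [S [oS FE]]] xI.
have [S' _ dS] := opoly_derive (opoly_widen (leqnSn n) oS).
have := is_vderive_comp (W_ode xI) (dS x) => dWS; eexists.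
apply: near_is_vderive dWS.
by apply: filterS (near_itv11 xI) => t tI; rewrite FE.
Qed.

(** The boundary terms vanish by [integral_derivative_eq0], which is applied
    to the real and to the imaginary part. *)
Lemma total_derivative_integral F G phi : weighted_poly F -> weighted_poly G ->
  (forall x : R, x \in `]-1, 1[%R ->
     is_vderive (fun t => (Qpoly t)%:C *: F t) x (G x)) ->
  scalar phi -> cintegral I (fun x => phi (G x)) = 0.
Proof.
move=> wF wG dFG ps.
have [FR FI] := weighted_poly_integrable wF ps.
have [GR GI] := weighted_poly_integrable wG ps.
have cG (x : R) : x \in `]-1, 1[%R ->
    {for x, continuous (fun t => complex.Re (phi (G t)))} /\
    {for x, continuous (fun t => complex.Im (phi (G t)))}.
  move=> xI; have [l /(_ _ ps) [dR dI]] := weighted_poly_derivable wG xI.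
  by split; [exact: is_derive_continuous dR|exact: is_derive_continuous dI].
rewrite /cintegral; congr (_ +i* _).
  apply: (@integral_derivative_eq0 _ (fun t => complex.Re (phi ((Qpoly t)%:C *: F t)))
    _ (fun t => complex.Re (phi (F t)))) => // x xI.
  - by have [] := dFG x xI _ ps.
  - by have [] := cG x xI.
  - by rewrite functionalZ // creM /= mul0r subr0.
apply: (@integral_derivative_eq0 _ (fun t => complex.Im (phi ((Qpoly t)%:C *: F t)))
  _ (fun t => complex.Im (phi (F t)))) => // x xI.
- by have [] := dFG x xI _ ps.
- by have [] := cG x xI.
- by rewrite functionalZ // cimM /= mul0r addr0.
Qed.

Lemma weighted_poly_rodrigues k i : (i <= k)%N ->
  weighted_poly (vderiven i (QW W k)).
Proof.
move=> ik; have [S oS SE] := rodrigues_derivative W_ode ik.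
have wWS : weighted_poly (fun x => (W x \o S x)%VF) by exists i.+1, S.
have [n [T [oT TE]]] := weighted_polyQ (k - i) wWS.
by exists n, T; split => // x xI; rewrite SE // TE.
Qed.

(** Integration by parts: the sum is the integral of the derivative of
    x^a (Q^k W)^(i), which still contains a factor Q because i < k.  For
    a = 0 the first term has the coefficient 0, whatever x ^+ a.-1 is. *)
Lemma moment_recurrence a k i phi : (i < k)%N -> scalar phi ->
  a%:R * cintegral I (fun x => (x ^+ a.-1)%:C * phi (vderiven i (QW W k) x)) +
  cintegral I (fun x => (x ^+ a)%:C * phi (vderiven i.+1 (QW W k) x)) = 0.
Proof.
move=> ik ps.
set T := vderiven i (QW W k); set T' := vderiven i.+1 (QW W k).
have wT : weighted_poly T by apply: weighted_poly_rodrigues; exact: ltnW.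
have wT' : weighted_poly T' by exact: weighted_poly_rodrigues.
have [S oS TE] := rodrigues_derivative W_ode (ltnW ik).
have wWS : weighted_poly (fun x => (W x \o S x)%VF) by exists i.+1, S.
have wF := weighted_polyX a (weighted_polyQ (k - i.+1) wWS).
have wG := weighted_polyD (weighted_polyZ a%:R (weighted_polyX a.-1 wT))
  (weighted_polyX a wT').
have iT := weighted_poly_integrable (weighted_polyX a.-1 wT) ps.
have iT' := weighted_poly_integrable (weighted_polyX a wT') ps.
have <- : cintegral I (fun x => phi (a%:R *: ((x ^+ a.-1)%:C *: T x) +
    (x ^+ a)%:C *: T' x)) = 0.
  apply: (total_derivative_integral wF wG) => // x xI.
  have dX : is_derive x 1 (fun t => t ^+ a) (a%:R * x ^+ a.-1).
    apply: (is_derive_congr (is_deriveX a (is_derive_id x 1))) => [t|].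
      by rewrite exprfctE.
    exact: mulr1.
  have := is_vderiveZ (is_cderive_real dX) (rodrigues_derivable W_ode ik xI).
  rewrite rmorphM rmorph_nat -scalerA; apply: near_is_vderive.
  apply: filterS (near_itv11 xI) => t tI.
  rewrite TE // -subnSK // exprS !rmorphM !scalerA /=.
  by congr (_ *: _); ring.
rewrite -cintegralMl //; last first.
  by apply: cintegrable_congr iT => // x _; rewrite functionalZ.
rewrite -cintegralD //; first last.
- by apply: cintegrable_congr iT' => // x _; rewrite functionalZ.
- apply: cintegrableMl => //.
  by apply: cintegrable_congr iT => // x _; rewrite functionalZ.
by apply: eq_cintegral => x _; rewrite functionalD // !functionalZ.
Qed.

(** Each integration by parts lowers both a and i by 1, and the power of x is
    exhausted before the derivatives are. *)
Lemma rodrigues_moment k i a phi : (a < i)%N -> (i <= k)%N -> scalar phi ->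
  cintegral I (fun x => (x ^+ a)%:C * phi (vderiven i (QW W k) x)) = 0.
Proof.
elim: a i => [|a IHa] [//|i] ai ik ps.
  have := moment_recurrence 0 ik ps; rewrite mul0r add0r => <-.
  by [].
have := moment_recurrence a.+1 ik ps.
by rewrite /= IHa // ?mulr0 ?add0r // ltnW.
Qed.

Lemma rodrigues_moments k m (psi : nat -> E -> R[i]) : (m <= k)%N ->
  (forall a, scalar (psi a)) ->
  cintegral I (fun x => \sum_(a < m) (x ^+ a)%:C * psi a (vderiven k (QW W k) x)) = 0.
Proof.
move=> mk ps; have wT := weighted_poly_rodrigues (leqnn k).
rewrite cintegral_sum // => [|a].
  by apply: big1 => a _; rewrite rodrigues_moment // (leq_trans (ltn_ord a)).
apply: cintegrable_power => //; first exact: subset_itv_oo_cc.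
exact: weighted_poly_integrable.
Qed.

Hypothesis W_inv : forall x : R, x \in `]-1, 1[%R -> ((W x)^-1 \o W x)%VF = \1%VF.

Let P k x := ((W x)^-1 \o vderiven k (QW W k) x)%VF.

(** After k derivatives no power of Q is left, and W cancels against its
    inverse. *)
Lemma rodrigues_polynomial k : exists2 S, opoly k.+1 S &
  forall x : R, x \in `]-1, 1[%R ->
    P k x = S x /\ (W x \o P k x)%VF = vderiven k (QW W k) x.
Proof.
have [S oS SE] := rodrigues_derivative W_ode (leqnn k).
exists S => // x xI.
have PS : P k x = S x.
  by rewrite /P SE // subnn scale1r comp_lfunA W_inv // comp_lfun1l.
by rewrite PS SE // subnn scale1r.
Qed.

Lemma quasi_orthogonality_left j k : (j < k)%N ->
  vintegral I (fun x => P j x \o W x \o P k x)%VF = 0.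
Proof.
move=> jk; have [S [c SE] PS] := rodrigues_polynomial j.
have [S' _ PS'] := rodrigues_polynomial k.
rewrite /vintegral big1 // => i _.
rewrite (@eq_cintegral _ _ _ (fun x => \sum_(a < j.+1)
    (x ^+ a)%:C * vcoord i (c a \o vderiven k (QW W k) x)%VF)).
  rewrite (rodrigues_moments (psi := fun a f => vcoord i (c a \o f)%VF)) ?scale0r //.
  by move=> a z u v; rewrite comp_lfunDr -comp_lfunZr vcoord_scalar.
move=> x /I_itv xI; have [PjS _] := PS x xI; have [_ WPk] := PS' x xI.
rewrite -comp_lfunA WPk PjS SE.
have phi_scalar : scalar (fun f : E => vcoord i (f \o vderiven k (QW W k) x)%VF).
  by move=> z u v; rewrite comp_lfunDl -comp_lfunZl vcoord_scalar.
rewrite (functional_sum phi_scalar); apply: eq_bigr => a _.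
by rewrite (functionalZ phi_scalar).
Qed.

Lemma quasi_orthogonality_right j k : (k < j)%N ->
  vintegral I (fun x => W x \o P j x \o P k x)%VF = 0.
Proof.
move=> kj; have [S [c SE] PS] := rodrigues_polynomial k.
have [S' _ PS'] := rodrigues_polynomial j.
rewrite /vintegral big1 // => i _.
rewrite (@eq_cintegral _ _ _ (fun x => \sum_(a < k.+1)
    (x ^+ a)%:C * vcoord i (vderiven j (QW W j) x \o c a)%VF)).
  rewrite (rodrigues_moments (psi := fun a f => vcoord i (f \o c a)%VF)) ?scale0r //.
  by move=> a z u v; rewrite comp_lfunDl -comp_lfunZl vcoord_scalar.
move=> x /I_itv xI; have [PkS _] := PS x xI; have [_ WPj] := PS' x xI.
rewrite WPj PkS SE.
have phi_scalar : scalar (fun f : E => vcoord i (vderiven j (QW W j) x \o f)%VF).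
  by move=> z u v; rewrite comp_lfunDr -comp_lfunZr vcoord_scalar.
rewrite (functional_sum phi_scalar); apply: eq_bigr => a _.
by rewrite (functionalZ phi_scalar).
Qed.

End QuasiOrthogonality.

Theorem mainTheorem6 (R : realType) (d : nat) (A B : 'M[R[i]]_d.+1)
    (lambda : 'I_d.+1 -> R[i]) (Y : R -> 'M[R[i]]_d.+1) (n : nat)
    (AB_diag : diagonalizable (A + B))
    (AB_eig : char_poly (A + B) = \prod_i ('X - (lambda i)%:P))
    (AB_nonres : nonresonant lambda)
    (Y_fund : fundamental_matrix A B Y) :
  let W := weight n Y in
  let P := rodrigues n Y in
  ((forall j k, vintegrable `]-1, 1[ (fun x => P j x \o W x \o P k x)%VF) ->
   forall j k, (j < k)%N ->
     vintegral `]-1, 1[ (fun x => P j x \o W x \o P k x)%VF = 0) /\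
  ((forall j k, vintegrable `]-1, 1[ (fun x => W x \o P j x \o P k x)%VF) ->
   forall j k, (k < j)%N ->
     vintegral `]-1, 1[ (fun x => W x \o P j x \o P k x)%VF = 0).
Proof.
move=> W P.
have [NA [NB W_ode]] := weight_derivative n Y_fund.
have W_inv (x : R) : x \in `]-1, 1[%R -> ((W x)^-1 \o W x)%VF = \1%VF.
  by move=> xI; apply: conj_subst_inv; case: (Y_fund x); rewrite ?inE.
have P0 (x : R) : x \in `]-1, 1[%R -> P 0%N x = \1%VF.
  by move=> xI; rewrite /P /rodrigues /= expr0 scale1r W_inv.
(* P 0 = 1 on the interval, so the case j = k = 0 says that W is integrable. *)
split=> int j k jk.
  apply: (quasi_orthogonality_left W_ode) => // i.
  apply: cintegrable_congr (int 0%N 0%N i) => // x xI.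
  by rewrite P0 ?comp_lfun1l ?comp_lfun1r // -inE.
apply: (quasi_orthogonality_right W_ode) => // i.
apply: cintegrable_congr (int 0%N 0%N i) => // x xI.
by rewrite P0 ?comp_lfun1r // -inE.
Qed.
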